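(* Let $\Omega$ be a compact metric space, let $\mathbb{T}=\mathbb{Z}$ or $\mathbb{T}=\mathbb{R}$, let $\varphi:\mathbb{R}\times\Omega\to\Omega$, $(t,x)\mapsto x\odot t$, be a continuous flow, and let $\omega:\mathbb{T}\times\Omega\to\Omega$ be a continuous flow with time $\mathbb{T}$ that commutes with $\varphi$. Suppose that the joint action of $\varphi$ and $\omega$ is minimal and that there is a $\varphi$-orbit that is invariant under $\omega$. Then there exists $\rho\in\mathbb{R}$ such that $\omega_t(x)=x\odot t\rho$ for all $x\in\Omega$ and $t\in\mathbb{T}$.
   Context: Commuting means $\omega_s(x\odot t)=\omega_s(x)\odot t$ for all $x\in\Omega$, $s\in\mathbb{T}$, $t\in\mathbb{R}$. The joint action of $\varphi$ and $\omega$ is the action of $\mathbb{R}\times\mathbb{T}$ on $\Omega$ given by $(s,t)\cdot x=\omega_t(x)\odot s$. The $\varphi$-orbit of $x$ is $\varphi_{\mathbb{R}}(x)=\{x\odot t\mid t\in\mathbb{R}\}$; it is invariant under $\omega$ if $\omega_t(\varphi_{\mathbb{R}}(x))=\varphi_{\mathbb{R}}(x)$ for all $t\in\mathbb{T}$. *)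

(* Defs.v *)
From HB Require Import structures.
From mathcomp Require Import all_boot all_order all_algebra.
From mathcomp Require Import all_classical all_reals all_analysis.

Set Implicit Arguments.
Unset Strict Implicit.
Unset Printing Implicit Defensive.

Import Order.TTheory GRing.Theory Num.Theory.
Import numFieldNormedType.Exports.

Local Open Scope classical_set_scope.
Local Open Scope ring_scope.

(* [int] carries no topology in the library; as a time domain it is discrete. *)
HB.instance Definition _ := hasNbhs.Build int principal_filter.
HB.instance Definition _ := Discrete_ofNbhs.Build int erefl.

Lemma int_sub_continuous :
  continuous (fun x : int * int => x.1 - x.2).
Proof.
move=> -[m n] A; rewrite nbhs_principalE => /principal_filterP /= Amn.
by exists ([set m], [set n]); [split; exact: discrete_set1 |
  move=> -[? ?] [/= -> ->]].
Qed.

HB.instance Definition _ :=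
  PreTopologicalNmodule_isTopologicalZmodule.Build int int_sub_continuous.

Section Flows.
Context {G : topologicalZmodType} {X : topologicalType}.

(* [f t x] is the position at time [t] of the point that starts at [x]. *)
Record continuous_flow (f : G -> X -> X) : Prop := ContinuousFlow {
  flow0 : forall x, f 0 x = x ;
  flowD : forall s t x, f (s + t) x = f s (f t x) ;
  flow_continuous : continuous (fun p : G * X => f p.1 p.2)
}.

End Flows.

Definition orbit_set {G X : Type} (a : G -> X -> X) (x : X) : set X :=
  range (a^~ x).

Definition minimal_action {G : Type} {X : topologicalType}
    (a : G -> X -> X) : Prop :=
  forall x, dense (orbit_set a x).

Section TwoFlows.
Context {G H X : Type}.

Definition commuting_flows (phi : G -> X -> X) (omega : H -> X -> X) : Prop :=
  forall x s t, omega s (phi t x) = phi t (omega s x).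

Definition joint_action (phi : G -> X -> X) (omega : H -> X -> X)
    (p : G * H) (x : X) : X :=
  phi p.1 (omega p.2 x).

Definition invariant_set (omega : H -> X -> X) (A : set X) : Prop :=
  forall t, omega t @` A = A.

End TwoFlows.

(* Main.v *)
(** Let [x0] have an [omega]-invariant [phi]-orbit. Each [omega t] and [phi s]
    commutes with the joint action, so if they agree at [x0] they agree on its
    dense joint orbit, hence everywhere. For [T = Z] it remains to pick [rho]
    with [omega 1 x0 = phi rho x0]. For [T = R], the set
    [C := {(t, s) | omega t x0 = phi s x0}] is a closed subgroup of the plane
    whose first projection is onto. It is therefore uncountable, hence not
    discrete, hence contains a line through the origin. If the line is
    [s = rho * t] we are done; if it is vertical, [phi] fixes [x0], whose orbit
    is then a point, and [rho = 0] works. *)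
Require Import Defs.
From mathcomp Require Import all_boot all_order all_algebra.
From mathcomp Require Import all_classical all_reals all_analysis.
From mathcomp Require Import lra.

Set Implicit Arguments.
Unset Strict Implicit.
Unset Printing Implicit Defensive.

Import Order.TTheory GRing.Theory Num.Theory.
Import numFieldNormedType.Exports.

Local Open Scope classical_set_scope.
Local Open Scope ring_scope.

(** At a limit point [x] of the equalizer, any neighbourhoods of [f x] and [g x] share a value
    [f z = g z] with [z] near [x], so a Hausdorff [Y] forces [f x = g x]. *)
Lemma closed_equalizer (X Y : topologicalType) (f g : X -> Y) :
  hausdorff_space Y -> continuous f -> continuous g ->
  closed [set x | f x = g x].
Proof.
move=> hY cf cg x xfg; apply: hY => A B nA nB.
have [z [/= fgz [Az Bz]]] : [set x | f x = g x] `&` (f @^-1` A `&` g @^-1` B)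
    !=set0.
  by apply: xfg; apply: filterI; [exact: cf | exact: cg].
by exists (f z); split => //; rewrite fgz.
Qed.

Lemma dense_closed_setT (X : topologicalType) (A B : set X) :
  dense A -> closed B -> A `<=` B -> forall x, B x.
Proof.
move=> dA cB AB x; apply: contrapT => nBx.
have [z [nBz /AB]] : ~` B `&` A !=set0.
  by apply: dA; [exists x | exact: closed_openC].
exact: nBz.
Qed.

(** An injective [f] would make the unit interval countable, hence of Lebesgue measure 0 instead of
    1. *)
Lemma noninjective_into_countType (R : realType) (T : countType) (f : R -> T) :
  exists x y, x != y /\ f x = f y.
Proof.
apply: contrapT => H.
have cR : countable `[0 : R, 1].
  apply/countable_injP; exists (pickle \o f) => x y _ _ /= fxy.
  apply/eqP/negPn/negP => nxy; apply: H; exists x, y; split=> //.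
  exact: (pcan_inj pickleK).
have := countable_lebesgue_measure0 cR.
rewrite lebesgue_measure_itv /= lte_fin ltr01 oppr0 adde0 => /eqP.
by rewrite eqe oner_eq0.
Qed.

Lemma same_floor_dist_lt (R : realType) (e x y : R) : 0 < e ->
  Num.floor (x / e) = Num.floor (y / e) -> `|x - y| < e.
Proof.
move=> e0 xy.
have /andP[x1 x2] := Num.Theory.floor_itv (x / e).
have /andP[y1 y2] := Num.Theory.floor_itv (y / e).
rewrite -xy in y1 y2; rewrite intrD in x2 y2.
suff : `|x / e - y / e| < 1.
  by rewrite -mulrBl normrM normfV (gtr0_norm e0) ltr_pdivrMr// mul1r.
by rewrite ltr_norml; apply/andP; split; lra.
Qed.

Section ClosedSubgroups.
Context {R : realType} {V : normedModType R}.
Variable C : set V.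
Hypotheses (C0 : C 0) (CB : forall v w, C v -> C w -> C (v - w)).

Lemma subgroup_mulrz (v : V) (m : int) : C v -> C (v *~ m).
Proof.
move=> Cv.
have CN w : C w -> C (- w) by move=> Cw; rewrite -[- w]add0r; exact: CB.
have Cn n : C (v *+ n).
  elim: n => [|n IH]; first by rewrite mulr0n.
  by rewrite mulrSr -[X in _ + X]opprK; apply: CB => //; exact: CN.
case: m => n; first exact: Cn.
by rewrite NegzE mulrNz; apply: CN; exact: Cn.
Qed.

(** Directions of ever shorter elements of [C] accumulate at some [u] on the compact sphere. The
    integer multiples of a short element form a fine net in its line, so they come arbitrarily close
    to every [l *: u]. *)
Lemma nondiscrete_closed_subgroup_line :
  compact [set v : V | `|v| = 1] -> closed C ->
  (forall e, 0 < e -> exists v, [/\ C v, v != 0 & `|v| < e]) ->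
  exists2 u : V, `|u| = 1 & forall l : R, C (l *: u).
Proof.
move=> sphere_compact C_closed small.
have /choice[c cP] (n : nat) : exists v, [/\ C v, v != 0 & `|v| < n.+1%:R^-1].
  by apply: small; rewrite invr_gt0.
pose w n := `|c n|^-1 *: c n.
have w1 n : `|w n| = 1.
  have [_ cn0 _] := cP n.
  by rewrite normrZ normfV normr_id mulVf// normr_eq0.
have [|u [/= u1 uw]] := sphere_compact (w @ \oo) _.
  by exists 0%N => // n _; exact: w1.
exists u => // l; apply: C_closed => B /nbhs_ballP[e /= e0 eB].
(* An error of this size in the direction [u], scaled by [l], stays below [e / 2]; the [+ 1] covers
   [l = 0]. *)
have d0 : 0 < e / 2 / (`|l| + 1) by rewrite !divr_gt0// ltr_wpDl.
have [N _ NP] : \forall n \near \oo, n.+1%:R^-1 < e / 2.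
  by apply: near_infty_natSinv_lt (PosNum (divr_gt0 e0 (ltr0n _ 2))).
(* Clustering is applied to the tail from [N] on, so that one index [k] gives both a direction near
   [u] and a short [c k]. *)
have [_ [[n /= Nn <-] wu]] : range (fun n => w (N + n)%N) `&`
    ball u (e / 2 / (`|l| + 1)) !=set0.
  apply: uw; last exact: nbhsx_ballx.
  by exists N => // n /= /subnKC <-; exists (n - N)%N.
move: wu; set k := (N + n)%N; rewrite -ball_normE /= => wu.
have [Ck ck0 ck] := cP k.
have kN : `|c k| < e / 2 by apply: lt_trans ck (NP _ _); rewrite /= leq_addr.
(* The integer multiple of [c k] closest to [l *: w k] from below. *)
exists (c k *~ Num.floor (l / `|c k|)); split; first exact: subgroup_mulrz.
apply: eB; rewrite -ball_normE /=.
(* Direction error plus rounding error: [l *: w k] is [(l / |c k|) *: c k], and rounding its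
   coefficient down costs at most one [c k]. *)
have -> : l *: u - c k *~ Num.floor (l / `|c k|) =
    l *: (u - w k) + (l / `|c k| - (Num.floor (l / `|c k|))%:~R) *: c k.
  by rewrite scalerBr scalerBl scaler_int scalerA addrA subrK.
rewrite (splitr e); apply: (le_lt_trans (ler_normD _ _)).
apply: ltr_leD.
  rewrite normrZ; apply: (@le_lt_trans _ _ ((`|l| + 1) * `|u - w k|)).
    by rewrite ler_wpM2r// lerDl.
  by rewrite mulrC -ltr_pdivlMr// ltr_wpDl.
rewrite normrZ; apply: (@le_trans _ _ `|c k|); last exact: ltW.
rewrite ler_piMl// ger0_norm ?subr_ge0 ?Num.Theory.floor_le//.
have /andP[_] := Num.Theory.floor_itv (l / `|c k|).
by rewrite intrD => ?; lra.
Qed.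

End ClosedSubgroups.

(** The norm of a pair is the maximum of the coordinate norms, so the sphere is a closed subset of a
    square. *)
Lemma compact_sphere_plane (R : realType) :
  compact [set v : R * R | `|v| = 1].
Proof.
have sq : compact (`[-1 : R, 1] `*` `[-1 : R, 1]).
  by apply: compact_setX; exact: segment_compact.
apply: subclosed_compact sq _.
  apply: closed_equalizer => [|x|x]; first exact: Rhausdorff.
    exact: norm_continuous.
  exact: cst_continuous.
move=> [a b] /= /eqP; rewrite /Num.norm/= => /eqP ab.
have: Num.max `|a| `|b| <= 1 by rewrite -ab.
by rewrite ge_max !ler_norml !in_itv /= => /andP[].
Qed.

Lemma closed_subgroup_plane_line (R : realType) (C : set (R * R)) :
  closed C -> C 0 -> (forall v w, C v -> C w -> C (v - w)) ->
  (forall t, exists s, C (t, s)) ->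
  (exists rho, forall t, C (t, t * rho)) \/ (forall s, C (0, s)).
Proof.
move=> C_closed C0 CB /choice[r rP].
have small e : 0 < e -> exists v, [/\ C v, v != 0 & `|v| < e].
  move=> e0.
  (* Pigeonhole on a grid of mesh [e]: two of the points [(t, r t)] share a cell. Their difference
     is short, and nonzero because its first coordinate is. *)
  have [x [y [xy [fx fy]]]] := noninjective_into_countType
    (fun t : R => (Num.floor (t / e), Num.floor (r t / e))).
  exists ((x, r x) - (y, r y)); split; first exact: CB.
    by rewrite subr_eq0; apply: contra xy => /eqP[-> _].
  rewrite [`|_|]/Num.norm /= gt_max.
  by rewrite !same_floor_dist_lt.
have [[a b] ab1 Cab] := nondiscrete_closed_subgroup_line C0 CB
  (@compact_sphere_plane R) C_closed small.
have Cl l : C (l * a, l * b) by exact: Cab.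
have [a0|a0] := eqVneq a 0; [right=> s|left].
  have b0 : b != 0.
    apply/eqP => b0; move: ab1; rewrite a0 b0 normr0 => /eqP.
    by rewrite eq_sym oner_eq0.
  by have := Cl (s / b); rewrite a0 mulr0 divfK.
by exists (b / a) => t; have := Cl (t / a); rewrite divfK// mulrA mulrAC.
Qed.

Section Flow.
Context {G : topologicalZmodType} {X : topologicalType}.

Lemma flow_map_continuous (f : G -> X -> X) (t : G) :
  continuous_flow f -> continuous (f t).
Proof.
move=> [_ _ cf] x; apply: (cvg_comp (pair t) _ _ (cf (t, x))).
by apply: cvg_pair; [exact: cvg_cst | exact: cvg_id].
Qed.

Lemma flow_orbit_continuous (f : G -> X -> X) (x : X) :
  continuous_flow f -> continuous (f^~ x).
Proof.
move=> [_ _ cf] t; apply: (cvg_comp (pair^~ x) _ _ (cf (t, x))).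
by apply: cvg_pair; [exact: cvg_id | exact: cvg_cst].
Qed.

Lemma flowC (f : G -> X -> X) (s t : G) (x : X) :
  continuous_flow f -> f s (f t x) = f t (f s x).
Proof. by move=> ff; rewrite -!(flowD ff) addrC. Qed.

Lemma flowK (f : G -> X -> X) (t : G) :
  continuous_flow f -> cancel (f t) (f (- t)).
Proof. by move=> ff x; rewrite -(flowD ff) addNr (flow0 ff). Qed.

End Flow.

Section CommutingFlows.
Context {G H : topologicalZmodType} {X : topologicalType}.
Context {phi : G -> X -> X} {omega : H -> X -> X}.
Hypotheses (X_hausdorff : hausdorff_space X)
  (phi_flow : continuous_flow phi) (omega_flow : continuous_flow omega)
  (phi_omega : commuting_flows phi omega)
  (phi_omega_minimal : minimal_action (joint_action phi omega)).

Lemma commuting_flows_eq (x0 : X) (t : H) (s : G) :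
  omega t x0 = phi s x0 -> forall x, omega t x = phi s x.
Proof.
move=> x0E; apply: (dense_closed_setT (phi_omega_minimal x0)).
  by apply: closed_equalizer => //; exact: flow_map_continuous.
move=> _ [[a b] _ <-]; rewrite /joint_action /= phi_omega.
by rewrite (flowC t)// x0E phi_omega (flowC a).
Qed.

Lemma invariant_orbit_shift (x0 : X) :
  invariant_set omega (orbit_set phi x0) ->
  forall t, exists s, omega t x0 = phi s x0.
Proof.
move=> inv t.
have : (omega t @` orbit_set phi x0) (omega t x0).
  by exists x0 => //; exists 0 => //; exact: flow0.
by rewrite inv => -[s _ <-]; exists s.
Qed.

End CommutingFlows.

Theorem proposition3p6 (R : realType) (Omega : metricType R)
    (Omega_compact : compact [set: Omega])
    (phi : R -> Omega -> Omega) (phi_flow : continuous_flow phi) :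
  (forall omega : int -> Omega -> Omega,
      continuous_flow omega ->
      commuting_flows phi omega ->
      minimal_action (joint_action phi omega) ->
      (exists x0 : Omega, invariant_set omega (orbit_set phi x0)) ->
      exists rho : R, forall (x : Omega) (t : int),
        omega t x = phi (t%:~R * rho) x) /\
  (forall omega : R -> Omega -> Omega,
      continuous_flow omega ->
      commuting_flows phi omega ->
      minimal_action (joint_action phi omega) ->
      (exists x0 : Omega, invariant_set omega (orbit_set phi x0)) ->
      exists rho : R, forall (x : Omega) (t : R),
        omega t x = phi (t * rho) x).
Proof.
have hO : hausdorff_space Omega by exact: metric_hausdorff.
split=> omega omega_flow comm min [x0 inv].
  have [rho rhoE] := invariant_orbit_shift phi_flow inv 1; exists rho.
  have omega1 := commuting_flows_eq hO phi_flow omega_flow comm min rhoE.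
  have omegan (n : nat) x : omega n x = phi (n%:R * rho) x.
    elim: n x => [|n IH] x.
      by rewrite mul0r (flow0 phi_flow) (flow0 omega_flow).
    rewrite -addn1 PoszD (flowD omega_flow) omega1 IH -(flowD phi_flow).
    by rewrite natrD mulrDl mul1r.
  move=> x [n|n]; first exact: omegan.
  (* For time [- n.+1], write [x] as [phi (n.+1 * rho)] of a point; by [omegan] this is [omega n.+1]
     of that point, which [omega] at the negative time undoes. *)
  rewrite NegzE mulrNz mulNr -[x in LHS](flowK (- (n.+1%:R * rho)) phi_flow).
  by rewrite opprK -omegan (flowK _ omega_flow).
pose C := [set v : R * R | omega v.1 x0 = phi v.2 x0].
have C_closed : closed C.
  apply: closed_equalizer => // v.
    apply: (@continuous_comp _ _ _ fst (omega^~ x0)); first exact: cvg_fst.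
    exact: flow_orbit_continuous.
  apply: (@continuous_comp _ _ _ snd (phi^~ x0)); first exact: cvg_snd.
  exact: flow_orbit_continuous.
have C0 : C 0 by rewrite /C /= (flow0 omega_flow) (flow0 phi_flow).
have CB v w : C v -> C w -> C (v - w).
  move=> Cv Cw; rewrite /C /= in Cv Cw *.
  (* The injective [omega w.1] turns the two sides into [omega v.1 x0] and [phi v.2 x0]. *)
  apply: (can_inj (flowK w.1 omega_flow)).
  rewrite -(flowD omega_flow) addrC subrK Cv comm Cw -(flowD phi_flow).
  by rewrite subrK.
have eqO := commuting_flows_eq hO phi_flow omega_flow comm min.
have shift := invariant_orbit_shift phi_flow inv.
have [[rho rhoE]|fixed] := closed_subgroup_plane_line C_closed C0 CB shift.
  by exists rho => x t; exact: eqO (rhoE t) x.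
(* It suffices to compare at [x0], which [phi] fixes; by [shift], [omega] then fixes it too. *)
exists 0 => x t; apply: (eqO x0).
have [s ->] := shift t.
have phi_fix r : phi r x0 = x0.
  by have /= <- := fixed r; rewrite (flow0 omega_flow).
by rewrite !phi_fix.
Qed.
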